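(* Let $f$ be a real-valued Z-additive function such that the series $\sum_{j\geqslant2}|f(F_j)|$ converges, and let $F$ be its limiting distribution function. For an integer $N\geqslant 2$ and real $T\geqslant1$ set $L=\lceil\log_\gamma(\sqrt5\,N)\rceil$ and $h=\lceil\log_\gamma(T\log T)\rceil$. Then for all real numbers $T\geqslant1$ such that $h\leqslant L/2$, \[ \|F_N-F\|_\infty\ll Q_F(1/T)+\frac{\log N}{T}+T\sum_{j>L-2h+1}|f(F_j)|, \] with an implicit constant independent of $N$ and $T$.
   Context: $F_0=0$, $F_1=1$, $F_k=F_{k-1}+F_{k-2}$ are the Fibonacci numbers and $\gamma=(1+\sqrt5)/2$. Every positive integer $n$ has a unique Zeckendorf representation $n=\sum_{i\geqslant2}\delta_i(n)F_i$ with $\delta_i(n)\in\{0,1\}$ and no two consecutive $\delta_i(n)$ equal to $1$. A function $f$ is Z-additive if $f(0)=0$ and $f(n)=\sum_{i\geqslant2}f(\delta_i(n)F_i)$. $F_N(y)=\frac1N\#\{n<N: f(n)\leqslant y\}$, $F(y)=\lim_{N\to\infty}F_N(y)$, $\|\cdot\|_\infty$ is the sup norm over $y\in\mathbb{R}$, and $Q_F(h)=\sup_{z\in\mathbb{R}}(F(z+h)-F(z))$ for $h>0$. *)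

(* Defs.v *)
From HB Require Import structures.
From mathcomp Require Import all_boot all_order all_algebra.
From mathcomp Require Import all_classical all_reals all_analysis.

Set Implicit Arguments.
Unset Strict Implicit.
Unset Printing Implicit Defensive.

Import Order.TTheory GRing.Theory Num.Theory.
Import numFieldNormedType.Exports.

Local Open Scope classical_set_scope.
Local Open Scope ring_scope.

Fixpoint fib (n : nat) : nat :=
  match n with
  | 0 => 0
  | n1.+1 => match n1 with
             | 0 => 1
             | n2.+1 => fib n1 + fib n2
             end
  end%N.

(* [d] is the digit sequence of the Zeckendorf representation of [n]; [m] is
   any bound on the support, so that the sum over all i >= 2 is finite. *)
Definition zeckendorf (n m : nat) (d : nat -> bool) : Prop :=
  [/\ forall i, d i -> (2 <= i < m)%N,
      forall i, ~~ (d i && d i.+1) &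
      n = (\sum_(2 <= i < m) d i * fib i)%N].

(* By uniqueness of the Zeckendorf representation, quantifying over all [d]
   amounts to taking the digits of [n]. *)
Definition Z_additive (R : realType) (f : nat -> R) : Prop :=
  f 0%N = 0 /\
  forall (n m : nat) (d : nat -> bool), (0 < n)%N -> zeckendorf n m d ->
    f n = \sum_(2 <= i < m) f (d i * fib i)%N.

Definition empirical_df (R : realType) (f : nat -> R) (N : nat) (y : R) : R :=
  #|[set n : 'I_N | f n <= y]%SET|%:R / N%:R.

Definition limiting_df (R : realType) (f : nat -> R) (F : R -> R) : Prop :=
  forall y : R, empirical_df f N y @[N --> \oo] --> F y.

Definition sup_norm (R : realType) (g : R -> R) : R :=
  sup (range (fun y : R => `|g y|)).

Definition concentration (R : realType) (F : R -> R) (h : R) : R :=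
  sup (range (fun z : R => F (z + h) - F z)).

Definition golden (R : realType) : R := (1 + Num.sqrt 5) / 2.

Definition loggold (R : realType) (x : R) : R := ln x / ln (golden R).

Definition Lindex (R : realType) (N : nat) : int :=
  Num.ceil (loggold (Num.sqrt 5 * N%:R : R)).

(* Extended-real valued because of T = 1, where T log T = 0: the logarithm
   [lne] has value -oo at 0 (whereas [ln 0 = 0]), so that the value is -oo at
   T = 1 and the usual integer for T > 1. *)
Definition hindex (R : realType) (T : R) : \bar R :=
  er_map (fun x : R => (Num.ceil x)%:~R)
    (lne (T * ln T)%:E * (ln (golden R))^-1%:E)%E.

(* Main.v *)
(** Fix k and let a(n) be the part of n carried by the Zeckendorf digits of
    index < k; up to s = \sum_(j >= k) |f (F_j)|, f n is f (a n). For a fixed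
    z, the count S N = #{n < N | f (a n) <= z} satisfies
    S (F_j + M) = S F_j + S M for j >= k and M <= F_(j-1), so that j |-> S F_j
    is eventually a Fibonacci recurrence: its dominant part is W F_j, the rest
    decays like (-1/gamma)^j, and summing over the digits of N gives
    S N = W N + O(F_k) with W independent of N. Comparing N with M -> oo,
    F (y - 2 s) - O(F_k / N) <= F_N y <= F (y + 2 s) + O(F_k / N).
    Subadditivity of Q_F gives Q_F (2 s) <= Q_F (1 / T) + 2 s T, and
    k = L - 2 h + 2 makes F_k / N = O((T log T)^-2). *)

Require Import Defs.
From HB Require Import structures.
From mathcomp Require Import all_boot all_order all_algebra.
From mathcomp Require Import all_classical all_reals all_analysis.
From mathcomp Require Import zify ring lra.

Import Order.TTheory GRing.Theory Num.Theory.
Import numFieldNormedType.Exports.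

Local Open Scope classical_set_scope.
Local Open Scope ring_scope.

(** * Fibonacci numbers and Zeckendorf digits *)

Lemma fibSS n : fib n.+2 = (fib n.+1 + fib n)%N.
Proof. by []. Qed.

Lemma fib_gt0 n : (0 < fib n.+1)%N.
Proof. by elim: n => // n IHn; rewrite fibSS addn_gt0 IHn. Qed.

Lemma leq_fib : {homo fib : m n / (m <= n)%N}.
Proof.
apply: (homo_leq leqnn leq_trans) => -[|n] //.
by rewrite fibSS leq_addr.
Qed.

Lemma ltn_fib_add2 n : (n < fib n.+2)%N.
Proof.
elim: n => // n IHn; rewrite fibSS.
by have := fib_gt0 n; lia.
Qed.

(** [G b i] stands both for [b * fib i] and for [f (b * fib i)]: one computation extends the digit
    sum and the sum giving [f]. *)
Lemma big_digits_recr (T : Type) (idx : T) (op : Monoid.law idx)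
    (d : nat -> bool) (G : bool -> nat -> T) j :
  (0 < j)%N -> (forall i, G false i = idx) -> d j = false ->
  \big[op/idx]_(2 <= i < j.+2) G (d i || (i == j.+1)) i =
  op (\big[op/idx]_(2 <= i < j) G (d i) i) (G true j.+1).
Proof.
move=> j0 G0 dj; rewrite big_nat_recr //= eqxx orbT; congr (op _ _).
transitivity (\big[op/idx]_(2 <= i < j.+1) G (d i) i).
  by apply: eq_big_nat => i /andP[_ ij]; rewrite (ltn_eqF ij) orbF.
case: j j0 dj => [|[|j]] // _ dj.
by rewrite big_nat_recr //= dj G0 Monoid.mulm1.
Qed.

(** The digits of [m] have index below [j], so index [j] stays empty and the new digit at [j.+1] has
    no neighbour. *)
Lemma zeckendorf_fibD j m d : (0 < j)%N -> zeckendorf m j d ->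
  zeckendorf (fib j.+1 + m) j.+2 (fun i => d i || (i == j.+1)).
Proof.
move=> j0 [dP dd dE]; split.
- move=> i /orP[/dP|/eqP->]; lia.
- move=> i; have := dd i; have := dP i; have := dP i.+1.
  case: (d i); case: (d i.+1) => //=; lia.
have dj : d j = false by apply/negP => /dP; rewrite ltnn andbF.
rewrite (@big_digits_recr _ _ _ d (fun b i => b * fib i)%N) //.
by rewrite mul1n -dE addnC.
Qed.

(** Greedy algorithm: if [fib k <= m < fib k.+1], the remainder [m - fib k] has digits of index
    below [k - 1], not adjacent to [k]. *)
Lemma zeckendorf_exists k m : (m < fib k)%N -> exists d, zeckendorf m k d.
Proof.
elim/ltn_ind: k m => -[|k] IHk m // ltm.
have [ltmk|lekm] := ltnP m (fib k).
  have [d [dP dd dE]] := IHk k (leqnn _) _ ltmk; exists d; split => //.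
    by move=> i /dP /andP[-> /ltnW].
  have [k1|k2] := leqP k 1; first by rewrite dE !big_geq //; lia.
  rewrite big_nat_recr //= -dE.
  case: (boolP (d k)) => [/dP|_]; first by rewrite ltnn andbF.
  by rewrite mul0n addn0.
case: k => [|[|k]] in IHk ltm lekm *.
- exists (fun=> false); split => //.
  by rewrite big_geq //; move: ltm; rewrite /=; lia.
- by move: ltm lekm; rewrite /=; lia.
have ltm' : (m - fib k.+2 < fib k.+1)%N.
  by move: ltm lekm; rewrite (fibSS k.+1); lia.
have [d /zeckendorf_fibD] := IHk k.+1 (leqnSn _) _ ltm'.
by rewrite subnKC // => /(_ isT); exists (fun i => d i || (i == k.+2)).
Qed.

Lemma Z_additive_fibD (R : realType) (f : nat -> R) j m :
  Z_additive f -> (0 < j)%N -> (m < fib j)%N ->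
  f (fib j.+1 + m)%N = f (fib j.+1) + f m.
Proof.
move=> [f0 fD] j0 ltm.
(* The digit formula speaks of positive integers, so [m = 0] rests on [f 0 = 0]. *)
have [->|m0] := posnP m; first by rewrite addn0 f0 addr0.
have [d dm] := zeckendorf_exists _ _ ltm.
rewrite (fD m j d m0 dm) (fD _ _ _ _ (zeckendorf_fibD _ _ _ j0 dm)).
  have dj : d j = false by apply/negP; case: dm => dP _ _ /dP; rewrite ltnn andbF.
  rewrite (@big_digits_recr _ _ _ d (fun b i => f (b * fib i)%N)) //.
  by rewrite mul1n addrC.
by rewrite addn_gt0 m0 orbT.
Qed.

(** * The low part of an integer *)

(* For [n < fib (k + i)], greedily removes the digits of index [>= k]. *)
Fixpoint strip k i n : nat :=
  if i is i'.+1 then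
    strip k i' (if (fib (k + i') <= n)%N then n - fib (k + i') else n)%N
  else n.

(* [n] is enough fuel, since [n < fib (k + n)] when [1 < k]. *)
Definition low_part k n := strip k n n.

Lemma strip_stable k i i' n : (n < fib (k + i))%N -> (n < fib (k + i'))%N ->
  strip k i n = strip k i' n.
Proof.
wlog lei : i i' / (i <= i')%N.
  move=> W; have [|/ltnW] := leqP i i'; first exact: W.
  by move=> le h h'; rewrite (W i' i).
move=> ltn _; rewrite -(subnK lei); elim: (i' - i)%N => //= d ->.
by rewrite leqNgt (leq_trans ltn) // leq_fib //; lia.
Qed.

Lemma ltn_fib_add k n : (1 < k)%N -> (n < fib (k + n))%N.
Proof.
by move=> k1; apply: leq_trans (ltn_fib_add2 n) _; rewrite leq_fib //; lia.
Qed.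

Lemma low_partE k i n : (1 < k)%N -> (n < fib (k + i))%N -> low_part k n = strip k i n.
Proof. by move=> k1 ni; apply: strip_stable => //; exact: ltn_fib_add. Qed.

(** The first greedy subtraction takes away exactly [fib j.+1]. *)
Lemma low_part_fibD k j m : (1 < k)%N -> (k <= j.+1)%N -> (m < fib j)%N ->
  low_part k (fib j.+1 + m) = low_part k m.
Proof.
move=> k1 kj mj; pose i := (j.+1 - k)%N.
have ki : (k + i = j.+1)%N by rewrite subnKC.
rewrite (low_partE k i.+1) //; last by rewrite addnS ki fibSS ltn_add2l.
rewrite /= ki leq_addr addKn -(low_partE k i) // ki.
by apply: leq_trans mj _; exact: leq_fib.
Qed.

(** Stripping a digit [j] changes the value by exactly [f (fib j)], and each index is visited
    once. *)
Lemma ler_dist_low_part (R : realType) (f : nat -> R) k i n :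
  Z_additive f -> (1 < k)%N -> (n < fib (k + i))%N ->
  `|f n - f (low_part k n)| <= \sum_(k <= j < k + i) `|f (fib j)|.
Proof.
move=> fA k1 ni; rewrite (low_partE k i) //.
elim: i n ni => [|i IHi] n ni /=.
  by rewrite addn0 big_geq // subrr normr0.
rewrite addnS big_nat_recr ?leq_addr //=.
case: leqP => le; last by rewrite -[leLHS]addr0 lerD ?IHi.
have [p kip] : exists p, (k + i)%N = p.+1 by exists (k + i).-1; lia.
set m := (n - fib (k + i))%N.
have ltm : (m < fib p)%N.
  by move: ni le; rewrite addnS /m kip fibSS; lia.
have -> : f n = f (fib (k + i)) + f m.
  rewrite -(subnKC le) -/m kip Z_additive_fibD //.
  by case: p {kip} ltm.
rewrite -addrA addrC; apply: le_trans (ler_normD _ _) _.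
rewrite lerD2r IHi // (leq_trans ltm) // kip; exact: leq_fib.
Qed.

(** * Linear growth of functions additive along Fibonacci numbers *)

Section LinearGrowth.
Variable R : realType.

(** [tau] is the inverse of the golden ratio, and [- tau] the other root of [x ^ 2 = x + 1]. *)
Let tau : R := golden R - 1.

Lemma golden_sqr : golden R ^+ 2 = golden R + 1.
Proof.
have s5 : Num.sqrt 5 ^+ 2 = 5 :> R by rewrite sqr_sqrtr.
by rewrite /golden; field: s5.
Qed.

Lemma golden_itv : 8 / 5 < golden R < 5 / 3.
Proof.
have s5 : Num.sqrt 5 ^+ 2 = 5 :> R by rewrite sqr_sqrtr.
have s0 : 0 <= Num.sqrt 5 :> R by rewrite sqrtr_ge0.
by rewrite /golden; apply/andP; split; nra.
Qed.

(** For any [u] obeying the Fibonacci recurrence, [u k.+1 + tau * u k] is multiplied by [golden] at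
    each step. *)
Lemma golden_expE k :
  (fib k.+1)%:R + tau * (fib k)%:R = golden R ^+ k :> R.
Proof.
elim: k => [|k IHk]; first by rewrite mulr0 addr0.
rewrite exprS -IHk fibSS natrD /tau; have := golden_sqr.
set g := golden R => g2.
transitivity ((fib k.+1)%:R * g + (g ^+ 2 - g) * (fib k)%:R); last by ring.
by rewrite g2; ring.
Qed.

(** The error [D] obeys the Fibonacci recurrence along [fib j] for large [j], and the choice of [W]
    leaves only its decaying component; a greedy expansion of [N] then gives a geometric series. *)
Lemma fib_additive_linear (k : nat) (S : nat -> R) :
  (forall N, 0 <= S N <= N%:R) ->
  (forall j M, (k <= j)%N -> (M <= fib j)%N ->
     S (fib j.+1 + M)%N = S (fib j.+1) + S M) ->
  exists W : R, forall N, `|S N - W * N%:R| <= 4 * (fib k.+1)%:R.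
Proof.
move=> SP SD.
have /andP[g1 g2] := golden_itv.
have tau0 : 0 < tau by rewrite /tau; lra.
have taule : tau <= 2 / 3 by rewrite /tau; lra.
have tau2 : tau ^+ 2 = 1 - tau.
  by rewrite /tau sqrrB golden_sqr; ring.
have gk0 : 0 < golden R ^+ k.+1 by rewrite exprn_gt0 //; lra.
(* This [W] annihilates the component of [D (fib j)] growing like [golden ^+ j]. *)
pose W := (S (fib k.+2) + tau * S (fib k.+1)) / golden R ^+ k.+1.
pose D N := S N - W * N%:R.
have DD j M : (k <= j)%N -> (M <= fib j)%N ->
    D (fib j.+1 + M)%N = D (fib j.+1) + D M.
  by move=> kj Mj; rewrite /D SD // natrD; ring.
have W01 : 0 <= W <= 1.
  have /andP[a0 a1] := SP (fib k.+2); have /andP[b0 b1] := SP (fib k.+1).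
  rewrite /W divr_ge0 /=; [|nra|exact: ltW].
  by rewrite ler_pdivrMr // mul1r -golden_expE; nra.
have Dle N : `|D N| <= N%:R.
  have /andP[a0 a1] := SP N; have /andP[w0 w1] := W01.
  by rewrite /D ler_norml; have := ler0n R N; nra.
(* The base case is the definition of [W]; the inductive step is [1 - tau = tau ^ 2]. *)
have Dfib i : D (fib (k.+2 + i)) = - tau * D (fib (k.+1 + i)).
  elim: i => [|i IHi].
    rewrite !addn0 /D.
    have e : W * golden R ^+ k.+1 = S (fib k.+2) + tau * S (fib k.+1).
      by rewrite /W divfK // gt_eqF.
    rewrite -golden_expE in e.
    by move: e; set x := W * _; rewrite /x; lra.
  rewrite !addnS !addSn fibSS DD; last 2 first.
  - by rewrite -addSn; lia.
  - exact/leq_fib.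
  have := IHi; rewrite !addSn => ->.
  rewrite mulrA -[X in _ + X = _]mul1r -mulrDl; congr (_ * _).
  by rewrite mulrNN -expr2 tau2; ring.
have DfibE i : `|D (fib (k.+1 + i))| <= tau ^+ i * (fib k.+1)%:R.
  elim: i => [|i IHi]; first by rewrite addn0 mul1r.
  rewrite addnS -addSn Dfib normrM normrN (gtr0_norm tau0) exprS -mulrA.
  by rewrite ler_pM2l.
(* The term [- 3 * tau ^ i] closes the induction: it absorbs the added [tau ^ i] because
   [tau <= 2 / 3]. *)
have key i : forall N, (N <= fib (k.+1 + i))%N ->
    `|D N| <= (4 - 3 * tau ^+ i) * (fib k.+1)%:R.
  elim: i => [|i IHi] N leN.
    rewrite expr0 mulr1 (_ : 4 - 3 = 1); last by ring.
    by rewrite mul1r (le_trans (Dle N)) // ler_nat -[k.+1]addn0.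
  have fk0 : 0 <= (fib k.+1)%:R :> R by [].
  have ti : 0 < tau ^+ i by rewrite exprn_gt0.
  have [/IHi le|/ltnW le] := leqP N (fib (k.+1 + i)).
    apply: le_trans le _; rewrite ler_wpM2r // exprS; nra.
  rewrite -(subnKC le) addSn DD; last 2 first.
  - lia.
  - by move: leN; rewrite addnS !addSn fibSS; lia.
  rewrite -addSn; apply: le_trans (ler_normD _ _) _.
  apply: (@le_trans _ _ (tau ^+ i * (fib k.+1)%:R
                         + (4 - 3 * tau ^+ i) * (fib k.+1)%:R)).
    rewrite lerD // IHi //.
    move: leN; rewrite addnS !addSn fibSS => leN.
    by rewrite leq_subLR (leq_trans leN) ?leq_add2l ?leq_fib.
  by rewrite -mulrDl ler_wpM2r // exprS; nra.
exists W => N.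
have ltN : (N <= fib (k.+1 + N.+1))%N.
  by apply: leq_trans (ltnW (ltn_fib_add2 N)) _; rewrite leq_fib //; lia.
apply: le_trans (key _ _ ltN) _; rewrite ler_wpM2r // gerBl mulr_ge0 //.
by rewrite exprn_ge0 // ltW.
Qed.

End LinearGrowth.

(** * Empirical and limiting distribution functions *)

Section DistributionFunctions.
Context {R : realType} (f : nat -> R).
Implicit Types (F : R -> R) (N M k : nat) (y z r : R).

Lemma empirical_dfE N y :
  empirical_df f N y = (\sum_(0 <= n < N) (f n <= y)%R%:R) / N%:R.
Proof.
rewrite /empirical_df; congr (_ / _).
rewrite big_mkord -sum1_card natr_sum big_mkcond /=.
by apply: eq_bigr => i _; rewrite inE; case: (_ <= _).
Qed.

Lemma empirical_df_itv N y : 0 <= empirical_df f N y <= 1.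
Proof.
rewrite /empirical_df divr_ge0 //=.
(* At [N = 0] the quotient is 0, because [0^-1 = 0]. *)
have [->|N0] := posnP N; first by rewrite invr0 mulr0.
by rewrite ler_pdivrMr ?ltr0n // mul1r ler_nat -[leqRHS]card_ord max_card.
Qed.

Lemma empirical_df_le N : {homo empirical_df f N : y z / y <= z}.
Proof.
move=> y z yz; rewrite !empirical_dfE ler_wpM2r ?invr_ge0 //.
apply: ler_sum => n _; rewrite ler_nat.
by case: leP => // /le_trans /(_ yz) ->.
Qed.

Lemma limiting_df_itv F y : limiting_df f F -> 0 <= F y <= 1.
Proof.
move=> /(_ y) Fy; apply/andP; split.
  by apply: (cvgr_to_ge Fy); near=> N; case/andP: (empirical_df_itv N y).
by apply: (cvgr_to_le Fy); near=> N; case/andP: (empirical_df_itv N y).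
Unshelve. all: by end_near. Qed.

Lemma limiting_df_le F : limiting_df f F -> {homo F : y z / y <= z}.
Proof.
move=> FF y z yz; apply: (ler_cvg_to (FF y) (FF z)).
by near=> N; exact: empirical_df_le.
Unshelve. all: by end_near. Qed.

(** For [n < M <= fib j], shifting by [fib j.+1] keeps the low part. The cut at [k.+1] admits every
    [j >= k]. *)
Lemma low_part_count_linear k z : (0 < k)%N ->
  exists W : R, forall N,
    `|\sum_(0 <= n < N) (f (low_part k.+1 n) <= z)%R%:R - W * N%:R|
      <= 4 * (fib k.+1)%:R.
Proof.
move=> k0; pose g n : R := (f (low_part k.+1 n) <= z)%R%:R.
apply: (@fib_additive_linear _ _ (fun N => \sum_(0 <= n < N) g n)).
  move=> N; rewrite sumr_ge0 //= /g.
  rewrite -natr_sum ler_nat -[leqRHS]subn0 -[leqRHS]muln1 -sum_nat_const_nat.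
  by apply: leq_sum => n _; exact: leq_b1.
move=> j M kj Mj; rewrite (@big_cat_nat _ _ _ (fib j.+1)) ?leq_addr //.
congr (_ + _); rewrite -{1}[fib j.+1]add0n big_addn addKn.
apply: eq_big_nat => n /andP[_ nM].
by rewrite /g addnC low_part_fibD // (leq_trans nM).
Qed.

(** Both counts are compared with that of [f (low_part k.+1 n) <= y + r], whose slope [W] is common
    to [N] and [M]; each passage between [f] and the low part shifts the threshold by [r]. *)
Lemma empirical_df_compare k r N M y : (0 < k)%N ->
  (forall n, `|f n - f (low_part k.+1 n)| <= r) -> (0 < N)%N -> (0 < M)%N ->
  empirical_df f N y <= empirical_df f M (y + 2 * r)
     + 4 * (fib k.+1)%:R * (N%:R^-1 + M%:R^-1).
Proof.
move=> k0 fr N0 M0; have [W WP] := low_part_count_linear k (y + r) k0.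
rewrite !empirical_dfE.
set c := 4 * _ in WP *.
have n0 : 0 < N%:R :> R by rewrite ltr0n.
have m0 : 0 < M%:R :> R by rewrite ltr0n.
have hN : \sum_(0 <= n < N) (f n <= y)%R%:R <= W * N%:R + c.
  apply: (@le_trans _ _ (\sum_(0 <= n < N) (f (low_part k.+1 n) <= y + r)%R%:R)).
    apply: ler_sum => n _; rewrite ler_nat; case: leP => // fy.
    suff -> : f (low_part k.+1 n) <= y + r by [].
    by have := fr n; rewrite ler_norml; lra.
  by have := WP N; rewrite ler_norml; lra.
have hM : W * M%:R - c <= \sum_(0 <= n < M) (f n <= y + 2 * r)%R%:R.
  apply: (@le_trans _ _ (\sum_(0 <= n < M) (f (low_part k.+1 n) <= y + r)%R%:R)).
    by have := WP M; rewrite ler_norml; lra.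
  apply: ler_sum => n _; rewrite ler_nat; case: leP => // fy.
  suff -> : f n <= y + 2 * r by [].
  by have := fr n; rewrite ler_norml; lra.
have eN : (\sum_(0 <= n < N) (f n <= y)%R%:R) / N%:R <= W + c / N%:R.
  by rewrite ler_pdivrMr // mulrDl divfK ?gt_eqF.
have eM : W - c / M%:R <= (\sum_(0 <= n < M) (f n <= y + 2 * r)%R%:R) / M%:R.
  by rewrite ler_pdivlMr // mulrBl divfK ?gt_eqF.
by rewrite mulrDr; lra.
Qed.

Lemma empirical_df_approx F k r N y : limiting_df f F -> (0 < k)%N ->
  (forall n, `|f n - f (low_part k.+1 n)| <= r) -> (0 < N)%N ->
  F (y - 2 * r) - 4 * (fib k.+1)%:R / N%:R <= empirical_df f N y
    <= F (y + 2 * r) + 4 * (fib k.+1)%:R / N%:R.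
Proof.
move=> FF k0 fr N0; set c := 4 * _.
(* Indices [n.+1] keep the second sample size positive as it tends to infinity. *)
have Ecvg z : empirical_df f n.+1 z @[n --> \oo] --> F z.
  by have := FF z; rewrite -cvg_shiftS.
have ccvg : c * n.+1%:R^-1 @[n --> \oo] --> (0 : R).
  by rewrite -[X in _ --> X](mulr0 c); apply: cvgMl_tmp; exact: cvg_harmonic.
apply/andP; split.
  rewrite lerBlDr -[leRHS]addr0.
  apply: (ler_cvg_to (Ecvg _) (cvgD (cvg_cst _) ccvg)); near=> n.
  have := empirical_df_compare k r n.+1 N (y - 2 * r) k0 fr isT N0.
  by rewrite subrK -/c (addrC n.+1%:R^-1) mulrDr addrA; apply.
rewrite -[leRHS]addr0.
apply: (ler_cvg_to (cvg_cst _) (cvgD (cvgD (Ecvg _) (cvg_cst (c / N%:R))) ccvg)).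
near=> n; have := empirical_df_compare k r N n.+1 y k0 fr N0 isT.
by rewrite -/c mulrDr addrA; apply.
Unshelve. all: by end_near. Qed.

End DistributionFunctions.

(** * The concentration function *)

Section Concentration.
Context {R : realType} (F : R -> R).
Hypothesis F_itv : forall y, 0 <= F y <= 1.
Hypothesis F_le : {homo F : y z / y <= z}.

Lemma le_concentration h z : F (z + h) - F z <= concentration F h.
Proof.
apply: ub_le_sup; last by exists z.
exists 1 => _ [y _ <-].
by have /andP[? ?] := F_itv y; have /andP[? ?] := F_itv (y + h); lra.
Qed.

Lemma concentration_itv h : 0 <= h -> 0 <= concentration F h <= 1.
Proof.
move=> h0; apply/andP; split.
  by apply: le_trans (le_concentration h 0); rewrite subr_ge0 F_le // lerDl.
apply: ge_sup; first by exists (F (0 + h) - F 0), 0.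
move=> _ [y _ <-].
by have /andP[? ?] := F_itv y; have /andP[? ?] := F_itv (y + h); lra.
Qed.

(** A length [s] is covered by [m.+1] steps of length [h], with [m = trunc (s / h)], each gaining at
    most [Q]; since [Q <= 1], [m] of them cost at most [s / h]. *)
Lemma le_concentrationD h s y : 0 < h -> 0 <= s ->
  F (y + s) - F y <= concentration F h + s / h.
Proof.
move=> h0 s0; set Q := concentration F h.
have /andP[_ Q1] := concentration_itv _ (ltW h0).
have FD i : F (y + i%:R * h) - F y <= i%:R * Q.
  elim: i => [|i IHi]; first by rewrite !mul0r addr0 subrr.
  have := le_concentration h (y + i%:R * h).
  by rewrite -/Q -natr1 !mulrDl !mul1r addrA; lra.
have /andP[tr1 tr2] := truncn_itv (divr_ge0 s0 (ltW h0)).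
set m := Num.trunc (s / h) in tr1 tr2.
have le1 : F (y + s) <= F (y + m.+1%:R * h).
  by apply: F_le; rewrite lerD2l -ler_pdivrMr // ltW.
have mQ : m%:R * Q <= m%:R by rewrite ler_piMr.
by have := FD m.+1; rewrite -[in m.+1%:R * Q]natr1 mulrDl mul1r; lra.
Qed.

End Concentration.

(** * Tails of a convergent series *)

Section FilteredSeries.
Context {R : realType} (u : nat -> R) (a : nat).
Hypothesis u_ge0 : forall n, 0 <= u n.
Hypothesis u_cvg : cvgn (fun n => \sum_(a <= j < n) u j).

Lemma nondecreasing_filtered_series (P : pred nat) :
  nondecreasing_seq (fun n => \sum_(a <= j < n | P j) u j).
Proof. by apply: nondecreasing_series => n _ _. Qed.

Lemma is_cvg_filtered_series (P : pred nat) :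
  cvgn (fun n => \sum_(a <= j < n | P j) u j).
Proof.
apply: nondecreasing_is_cvgn; first exact: nondecreasing_filtered_series.
exists (limn (fun n => \sum_(a <= j < n) u j)) => _ [n _ <-].
apply: le_trans (nondecreasing_cvgn_le _ u_cvg n).
  by rewrite [leLHS]big_mkcond ler_sum // => j _; case: ifP.
exact: nondecreasing_filtered_series.
Qed.

(** From [k] on the filter keeps every term, and the partial sums increase to the limit. *)
Lemma ler_filtered_series (P : pred nat) k n :
  (a <= k)%N -> (forall j, (k <= j)%N -> P j) ->
  \sum_(k <= j < n) u j <= \big[+%R/0]_(a <= j <oo | P j) u j.
Proof.
move=> ak kP; apply: le_trans (nondecreasing_cvgn_le
  (nondecreasing_filtered_series P) (is_cvg_filtered_series P) n).
have [nk|/ltnW kn] := leqP n k; first by rewrite big_geq // sumr_ge0.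
rewrite (big_cat_nat ak kn) /= -[leLHS]add0r lerD ?sumr_ge0 //.
rewrite le_eqVlt; apply/orP; left; apply/eqP.
rewrite [LHS]big_nat_cond [RHS]big_nat_cond; apply: eq_bigl => j.
by case: (boolP (k <= j < n)%N) => //= /andP[/kP ->].
Qed.

End FilteredSeries.

(** * Sup-norm estimate and choice of the cut *)

(** Each shift of [F] by [2 * s] costs at most [concentration F h + 2 * s / h]. *)
Lemma empirical_df_dist (R : realType) (f : nat -> R) (F : R -> R) k N (h s y : R) :
  Z_additive f -> limiting_df f F -> (0 < k)%N -> (0 < N)%N -> 0 < h ->
  (forall n, \sum_(k.+1 <= j < n) `|f (fib j)| <= s) ->
  `|empirical_df f N y - F y| <=
    concentration F h + 2 * s / h + 4 * (fib k.+1)%:R / N%:R.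
Proof.
move=> fA FF k0 N0 h0 fs.
have s0 : 0 <= s by have := fs 0; rewrite big_geq.
have fr n : `|f n - f (low_part k.+1 n)| <= s.
  by apply: le_trans (ler_dist_low_part _ _ _ _ _ fA _ (ltn_fib_add k.+1 n _)) _.
have /andP[lo hi] := empirical_df_approx f F k s N y FF k0 fr N0.
have Fi := fun y => limiting_df_itv f F y FF.
have Fl := limiting_df_le f F FF.
have s20 : 0 <= 2 * s by lra.
have up := le_concentrationD F Fi Fl h _ y h0 s20.
have := le_concentrationD F Fi Fl h _ (y - 2 * s) h0 s20.
by rewrite subrK ler_norml; lra.
Qed.

Lemma hindexE (R : realType) (T : R) : 1 < T ->
  hindex T = ((Num.ceil (loggold (T * ln T)))%:~R)%:E.
Proof.
move=> T1; rewrite /hindex lne_EFin //.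
by rewrite mulr_gt0 ?ln_gt0 //; lra.
Qed.

(** Here [fib k.+1 <= golden ^ k] with [k = L - 2 H + 1], while [golden ^ L <= golden * sqrt 5 * N]
    and [golden ^ H >= T ln T]. The constant 15 generously bounds [sqrt 5 * golden ^ 2]. *)
Lemma fib_le_index (R : realType) N k (T : R) : (0 < N)%N -> 1 < T ->
  (k.+1%:R : R) = (Lindex R N)%:~R - 2 * (Num.ceil (loggold (T * ln T)))%:~R + 2 ->
  (fib k.+1)%:R <= 15 * N%:R / (T * ln T) ^+ 2.
Proof.
move=> N0 T1; set H := Num.ceil _; set x := T * ln T => kE.
have n0 : 0 < N%:R :> R by rewrite ltr0n.
have x0 : 0 < x by rewrite mulr_gt0 ?ln_gt0 //; lra.
have /andP[g1 g2] := golden_itv R.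
set g := golden R in g1 g2.
have g0 : 0 < g by lra.
have lg0 : 0 < ln g by rewrite ln_gt0 //; lra.
have s5 : Num.sqrt 5 ^+ 2 = 5 :> R by rewrite sqr_sqrtr.
have s0 : 0 < Num.sqrt 5 :> R by rewrite sqrtr_gt0.
have s5N : 0 < Num.sqrt 5 * N%:R :> R by rewrite mulr_gt0.
have leL : (Lindex R N)%:~R * ln g <= ln (Num.sqrt 5 * N%:R) + ln g.
  have /andP[+ _] := ceil_itv (loggold (Num.sqrt 5 * N%:R : R)).
  by rewrite -/(Lindex R N) intrB /loggold -/g ltr_pdivlMr // mulrBl mul1r; lra.
have leH : ln x <= H%:~R * ln g.
  by rewrite -ler_pdivrMr //; exact: ceil_ge.
have gkle : g ^+ k * x ^+ 2 <= Num.sqrt 5 * N%:R * g ^+ 2.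
  have gk0 : 0 < g ^+ k by rewrite exprn_gt0.
  have g20 : 0 < g ^+ 2 by rewrite exprn_gt0.
  have x20 : 0 < x ^+ 2 by rewrite exprn_gt0.
  rewrite -ler_ln ?posrE; [|exact: mulr_gt0..].
  rewrite (lnM gk0 x20) (lnM s5N g20) !lnXn //.
  have kg : k%:R * ln g = (Lindex R N)%:~R * ln g - 2 * (H%:~R * ln g) + ln g.
    have -> : k%:R = k.+1%:R - 1 :> R by rewrite -natr1 addrK.
    by rewrite kE; ring.
  rewrite -(mulr_natl (ln g) k) kg; lra.
have fk : (fib k.+1)%:R <= g ^+ k.
  rewrite -golden_expE lerDl mulr_ge0 //; rewrite -/g; lra.
rewrite ler_pdivlMr ?exprn_gt0 //.
apply: (@le_trans _ _ (g ^+ k * x ^+ 2)).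
  by rewrite ler_wpM2r // exprn_ge0 // ltW.
apply: le_trans gkle _.
rewrite mulrAC ler_pM2r //.
have : g ^+ 2 <= 3 by rewrite golden_sqr -/g; lra.
nra.
Qed.

Theorem theorem8 (R : realType) (f : nat -> R) (F : R -> R)
    (f_add : Z_additive f)
    (f_cvg : cvgn (fun n : nat => \sum_(2 <= j < n) `|f (fib j)|))
    (F_lim : limiting_df f F) :
  exists C : R, 0 < C /\
    forall (N : nat) (T : R), (2 <= N)%N -> 1 <= T ->
    let L : R := (Lindex R N)%:~R in
    let h : \bar R := hindex T in
    (h <= (L / 2)%:E)%E ->
    sup_norm (fun y => empirical_df f N y - F y)
      <= C * (concentration F (1 / T) + ln N%:R / T
              + T * \big[+%R/0]_(2 <= j <oo | (L%:E - 2%:E * h + 1 < j%:R%:E)%E)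
                      `|f (fib j)|).
Proof.
have Fi := fun y => limiting_df_itv f F y F_lim.
have Fl := limiting_df_le f F F_lim.
pose l : R := ln 2.
have l0 : 0 < l by rewrite ln_gt0 // ltr1n.
(* The 2 serves the concentration and the tail, [2 / l] the range [T < 2], and [60 / l ^ 3], with 60
   = 4 * 15, the term in [fib k.+1 / N]. *)
exists (2 + 2 / l + 60 / l ^+ 3); split.
  by rewrite addr_gt0 ?divr_gt0 ?exprn_gt0 // addr_gt0 // divr_gt0.
move=> N T N2 T1 L h hL.
have T0 : 0 < T by lra.
have N0 : (0 < N)%N by lia.
have n0 : 0 < N%:R :> R by rewrite ltr0n.
have lN : l <= ln N%:R by rewrite ler_ln ?posrE // ler_nat.
set S := \big[_/_]_(_ <= _ <oo | _) _.
have d0 : 0 < 1 / T by rewrite divr_gt0.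
have /andP[Q0 Q1] := concentration_itv F Fi Fl _ (ltW d0).
set Q := concentration _ _ in Q0 Q1 *.
have S0 : 0 <= S.
  apply: le_trans (nondecreasing_cvgn_le (nondecreasing_filtered_series
    _ _ (fun n => normr_ge0 _) _)
    (is_cvg_filtered_series _ _ (fun n => normr_ge0 _) f_cvg _) 0).
  by rewrite big_geq.
have TS0 : 0 <= T * S by rewrite mulr_ge0 // ltW.
have lNT : 0 < ln N%:R / T by rewrite divr_gt0 //; lra.
have il : 0 < 1 / l by rewrite divr_gt0.
have il3 : 0 < 1 / l ^+ 3 by rewrite divr_gt0 // exprn_gt0.
rewrite (_ : 2 + 2 / l + 60 / l ^+ 3 = 2 + 2 * (1 / l) + 60 * (1 / l ^+ 3));
  last by rewrite !mulrA !mulr1.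
apply: ge_sup; first by exists `|empirical_df f N 0 - F 0|, 0.
move=> _ [y _ <-].
(* For [T < 2], including [T = 1] where [h] is -oo, the trivial bound 1 suffices, since
   [ln N / T >= l / 2]. *)
have [T2|T2] := ltP T 2.
  have e1 : `|empirical_df f N y - F y| <= 1.
    have /andP[? ?] := Fi y; have /andP[? ?] := empirical_df_itv f N y.
    by rewrite ler_norml; lra.
  apply: le_trans e1 _.
  have : 1 <= 2 * (1 / l) * (ln N%:R / T).
    rewrite (_ : 2 * (1 / l) * (ln N%:R / T) = 2 * ln N%:R / (l * T)); last first.
      by field; rewrite !gt_eqF.
    by rewrite ler_pdivlMr ?mulr_gt0 // mul1r; nra.
  by nra.
have T1' : 1 < T by lra.
pose H := Num.ceil (loggold (T * ln T)).
have hE : h = H%:~R%:E by rewrite /h hindexE.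
have : 0 <= L - 2 * H%:~R by move: hL; rewrite hE lee_fin; lra.
have LHE : L - 2 * H%:~R = (Lindex R N - 2 * H)%:~R.
  by rewrite intrB intrM.
rewrite LHE ler0z => k0.
(* [k.+1 = L - 2 H + 2] is the first index of the tail [S]; the hypothesis on [h] makes the integer
   under [absz] nonnegative. *)
pose k := (absz (Lindex R N - 2 * H)%R).+1.
have kE : (k.+1%:R : R) = L - 2 * H%:~R + 2.
  by rewrite LHE /k -addn2 natrD natr_absz ger0_norm.
have tail n : \sum_(k.+1 <= j < n) `|f (fib j)| <= S.
  apply: ler_filtered_series => // j kj.
  rewrite hE -EFinM -EFinB -EFinD lte_fin.
  have : (k.+1%:R : R) <= j%:R by rewrite ler_nat.
  by rewrite kE; lra.
have := empirical_df_dist R f F k N (1 / T) S y f_add F_lim isT N0 d0 tail.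
move=> /le_trans; apply.
have fk := fib_le_index R N k T N0 T1' kE.
(* As [ln N / l], [ln T / l] and [T] are at least 1, a bound in [(T ln T) ^ -2] yields one in
   [ln N / T]. *)
have fkN : 4 * (fib k.+1)%:R / N%:R <= 60 * (1 / l ^+ 3) * (ln N%:R / T).
  rewrite ler_pdivrMr //.
  apply: (@le_trans _ _ (60 * N%:R / (T * ln T) ^+ 2)).
    set v := (_ ^+ 2)^-1 in fk *; move: fk; lra.
  have lT : l <= ln T by rewrite ler_ln ?posrE.
  have x0 : 0 < (T * ln T) ^+ 2 by rewrite exprn_gt0 // mulr_gt0 //; lra.
  rewrite ler_pdivrMr // (_ : 60 * (1 / l ^+ 3) * (ln N%:R / T) * N%:R * (T * ln T) ^+ 2 =
    60 * N%:R * ((ln N%:R / l) * (ln T / l) ^+ 2 * T)); last first.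
    by field; rewrite !gt_eqF.
  have r1 : 1 <= ln N%:R / l by rewrite ler_pdivlMr // mul1r.
  have r2 : 1 <= ln T / l by rewrite ler_pdivlMr // mul1r.
  have r3 : 1 <= (ln T / l) ^+ 2 by rewrite exprn_ege1.
  rewrite -[leLHS]mulr1 ler_pM2l ?mulr_gt0 //.
  by rewrite -[leLHS]mulr1 ler_pM // ?mulr_ge1 //; nra.
rewrite -/Q (_ : 2 * S / (1 / T) = 2 * (T * S)); last first.
  by field; rewrite gt_eqF.
by nra.
Qed.
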